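(* Let $n\ge 4$ and let $1<r<n$. Every regular subsemigroup of $T_n$ that is generated by mappings all of rank $r$, and that has a unique maximal $\mathcal{J}$-class, is generated by at most $S(n,r)$ elements, where $S(n,r)$ denotes the Stirling number of the second kind.
   Context: $T_n$ is the full transformation monoid on $\{1,\dots,n\}$. The rank of a mapping $\alpha\in T_n$ is $|\mathrm{im}\,\alpha|$. A semigroup $S$ is regular if for every $a\in S$ there is $x\in S$ with $axa=a$. The $\mathcal{J}$-classes are those of Green's relation $\mathcal{J}$ of the subsemigroup itself, and ''maximal'' refers to the usual order on $\mathcal{J}$-classes ($J_a\le J_b$ iff the principal two-sided ideal of $a$ is contained in that of $b$). ''Generated'' means generated as a semigroup. $S(n,r)$ is the number of partitions of an $n$-element set into $r$ non-empty classes. *)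

(* Defs.v *)
From HB Require Import structures.
From mathcomp Require Import all_boot.

Set Implicit Arguments.
Unset Strict Implicit.
Unset Printing Implicit Defensive.

Local Open Scope group_scope.

(* An alias of the finite function type, so that it can carry composition as
   its product. *)
Definition trans (n : nat) : Type := {ffun 'I_n -> 'I_n}.

HB.instance Definition _ n := Finite.on (trans n).

Section TransMonoid.

Variable n : nat.
Implicit Types a b c : trans n.

(* Mappings act on the right: a * b is a followed by b. *)
Definition trans_mul a b : trans n := [ffun x => b (a x)].
Definition trans_one : trans n := [ffun x => x].

Lemma trans_mulA : associative trans_mul.
Proof. by move=> a b c; apply/ffunP=> x; rewrite !ffunE. Qed.

Lemma trans_mul1 : left_id trans_one trans_mul.
Proof. by move=> a; apply/ffunP=> x; rewrite !ffunE. Qed.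

Lemma trans_mulr1 : right_id trans_one trans_mul.
Proof. by move=> a; apply/ffunP=> x; rewrite !ffunE. Qed.

HB.instance Definition _ :=
  isMonoid.Build (trans n) trans_mulA trans_mul1 trans_mulr1.

End TransMonoid.

Section Subsemigroups.

Variable n : nat.
Implicit Types (a b x y : trans n) (A S U J K : {set trans n}).

Definition trans_rank a : nat := #|a @: [set: 'I_n]|.

Definition subsemigroup S : Prop := S != set0 /\ mulg_closed S.

Definition regular S : Prop :=
  forall a, a \in S -> exists2 x, x \in S & a * x * a = a.

(* S is the least multiplicatively closed set containing A. *)
Definition generates A S : Prop :=
  [/\ mulg_closed S, A \subset S
    & forall U, mulg_closed U -> A \subset U -> S \subset U].

(* The principal two-sided ideal S^1 a S^1 of the semigroup S, where S^1 is S
   with an identity adjoined if necessary. *)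
Definition pideal S a : {set trans n} :=
  a |: [set x * a | x : trans n in S] :|: [set a * y | y : trans n in S]
    :|: [set x * a * y | x : trans n in S, y : trans n in S].

Definition Jclass S a : {set trans n} :=
  [set b in S | pideal S b == pideal S a].

Definition Jclasses S : {set {set trans n}} := [set Jclass S a | a : trans n in S].

Definition Jclass_le S J K : Prop :=
  exists a b, [/\ a \in J, b \in K & pideal S a \subset pideal S b].

Definition maximal_Jclass S J : Prop :=
  J \in Jclasses S /\
  forall K, K \in Jclasses S -> Jclass_le S J K -> K = J.

End Subsemigroups.

Definition stirling2 (n r : nat) : nat :=
  #|[set P : {set {set 'I_n}} | partition P [set: 'I_n] & #|P| == r]|.

(* Main.v *)
Require Import Defs.
From mathcomp Require Import all_boot zify.

Set Implicit Arguments.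
Unset Strict Implicit.
Unset Printing Implicit Defensive.

(** Let [J] be the set of elements of rank [r] in [S].  Because the maximal
    J-class is unique, [J] is that class: every kernel and every image
    occurring in [J] occur together in some element of [J].  It suffices to
    generate [J].  Choose a maximal set of [p] elements of [J] whose image is a
    transversal of their kernel, with distinct kernels and distinct images, and
    join them by a cycle of [p] generators, the kernel of each member with the
    image of the next.  By maximality every other generator can be inserted in
    this cycle, so it can serve one unmatched kernel and one unmatched image
    while its component in the maximal subgroup, a group of order at most [r!],
    remains free.  Hence [N] generators suffice as soon as [N] is at least the
    number of kernels, the number of images, and [p + log2 (r!)]; all three are
    at most [S(n, r)] because ['C(n, r) + log2 (r!) <= S(n, r)]. *)

(** * Lower bounds for Stirling numbers by counting words *)

(* A partition of [{0, ..., n - 1}] is encoded by the word whose [i]-th letter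
   is the least element of the block of [i]. *)
Fixpoint block_min_words n r : seq (seq nat) :=
  match n, r with
  | 0, 0 => [:: [::]]
  | 0, _.+1 => [::]
  | _.+1, 0 => [::]
  | n'.+1, r'.+1 =>
      [seq rcons w v | w <- block_min_words n' r, v <- undup w]
        ++ [seq rcons w n' | w <- block_min_words n' r']
  end.

(** Read as a map on positions, the word is idempotent and never exceeds its position; its [r]
    distinct letters are the block minima. *)
Lemma block_min_wordsP n r w : w \in block_min_words n r ->
  [/\ size w = n, size (undup w) = r &
      forall i, i < n -> nth 0 w i <= i /\ nth 0 w (nth 0 w i) = nth 0 w i].
Proof.
elim: n r w => [|n IHn] [|r] w //=.
  by rewrite inE => /eqP->.
rewrite mem_cat => /orP[/allpairsPdep[u [v [/IHn[szu rku idu] vu ->]]]|].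
  rewrite mem_undup in vu; have := vu; rewrite -index_mem szu => ltvn.
  have [] := idu _ ltvn; rewrite nth_index // => levi idv.
  split; first by rewrite size_rcons szu.
    rewrite -rku; apply: perm_size; apply: uniq_perm; rewrite ?undup_uniq //.
    move=> x; rewrite !mem_undup mem_rcons inE.
    by case: eqP => // ->; rewrite vu.
  move=> i; rewrite ltnS leq_eqVlt => /orP[/eqP->|ltin].
    have ltv : v < n by apply: leq_ltn_trans ltvn.
    by rewrite nth_rcons szu ltnn eqxx nth_rcons szu ltv idv ltnW.
  have [lei idi] := idu _ ltin.
  by rewrite nth_rcons szu ltin nth_rcons szu (leq_ltn_trans lei ltin).
move=> /mapP[u /IHn[szu rku idu] ->].
(* All letters of [u] are below [n], so the appended letter [n] opens a new block. *)
have ltu x : x \in u -> x < n.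
  move=> xu; have ltxn : index x u < n by rewrite -szu index_mem.
  by have [] := idu _ ltxn; rewrite nth_index // => /leq_ltn_trans->.
split; first by rewrite size_rcons szu.
  rewrite undup_rcons size_rcons -rku; congr S; congr size.
  apply/all_filterP/allP => x; rewrite mem_undup => /ltu ltxn.
  by rewrite neq_ltn ltxn.
move=> i; rewrite ltnS leq_eqVlt => /orP[/eqP->|ltin].
  by rewrite nth_rcons szu ltnn eqxx nth_rcons szu ltnn eqxx.
have [lei idi] := idu _ ltin.
by rewrite nth_rcons szu ltin nth_rcons szu (leq_ltn_trans lei ltin).
Qed.

(** The two lists of the recursion are disjoint: a last letter that already occurs earlier is
    smaller than [n']. *)
Lemma block_min_words_uniq n r : uniq (block_min_words n r).
Proof.
elim: n r => [|n IHn] [|r] //=.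
rewrite cat_uniq; apply/and3P; split.
- apply: allpairs_uniq_dep => // [w _|]; first exact: undup_uniq.
  by move=> [w v] [w' v'] _ _ /= /rcons_inj[-> ->].
- apply/hasPn => w /mapP[u _ ->]; apply/allpairsPdep => -[x [v [xP vx]]].
  move=> /rcons_inj[_ nv]; subst v; have [szx _ idx] := block_min_wordsP xP.
  rewrite mem_undup in vx; have := vx; rewrite -index_mem szx => lti.
  by have [] := idx _ lti; rewrite nth_index // leqNgt lti.
- by rewrite map_inj_uniq // => x y /rcons_inj[].
Qed.

(** The Stirling recurrence: a new point joins one of [r.+1] blocks, each named by its own letter,
    or forms a block alone. *)
Lemma size_block_min_words_rec n r :
  size (block_min_words n.+1 r.+1) =
  r.+1 * size (block_min_words n r.+1) + size (block_min_words n r).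
Proof.
rewrite /= size_cat size_map size_allpairs_dep; congr addn.
have: {in block_min_words n r.+1, forall w, size (undup w) = r.+1}.
  by move=> w /block_min_wordsP[].
move: (block_min_words n r.+1) => s; elim: s => [|w s IHs] ws /=.
  by rewrite muln0.
rewrite mulnS ws ?mem_head // IHs // => x xs.
by apply: ws; rewrite inE xs orbT.
Qed.

Lemma size_block_min_words_big n r : n < r -> size (block_min_words n r) = 0.
Proof.
elim: n r => [|n IHn] [|r] // ltnr.
by rewrite size_block_min_words_rec !IHn //; lia.
Qed.

Lemma size_block_min_words_diag n : size (block_min_words n n) = 1.
Proof.
by elim: n => // n IHn; rewrite size_block_min_words_rec IHn
  size_block_min_words_big ?muln0.
Qed.

Lemma size_block_min_words_subdiag r :
  size (block_min_words r.+1 r) = 'C(r.+1, 2).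
Proof.
elim: r => // r IHr.
by rewrite size_block_min_words_rec IHr size_block_min_words_diag (binS r.+1 1) bin1; lia.
Qed.

Lemma size_block_min_words1 n : size (block_min_words n.+1 1) = 1.
Proof.
elim: n => // n IHn.
by rewrite size_block_min_words_rec IHn.
Qed.

(** At [n = 3] both sides are 3, so 4 is the first case (6 < 7); from there the doubling on the
    right outweighs the increment [n] on the left. *)
Lemma bin2_lt_size_block_min_words n :
  4 <= n -> 'C(n, 2) < size (block_min_words n 2).
Proof.
case: n => [|[|[|[|n]]]] // _.
elim: n => // n IHn.
rewrite size_block_min_words_rec size_block_min_words1.
have -> : 'C(n.+4.+1, 2) = 'C(n.+4, 2) + n.+4 by rewrite (binS n.+4 1) bin1.
have : n.+4 <= 'C(n.+4, 2).+1 by rewrite (binS n.+3 1) bin1; lia.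
lia.
Qed.

(** Equality holds at [n = r + 1]; from there Pascal's rule is compared with the Stirling
    recurrence. *)
Lemma bin_leq_size_block_min_words n r : 2 < r < n ->
  'C(n, r) + 'C(r, 2) <= (size (block_min_words n r)).+1.
Proof.
elim: n r => [|n IHn] [|r] // /andP[lt2r]; first by rewrite ltn0.
rewrite ltnS leq_eqVlt => /orP[/eqP<-|ltrn].
  by rewrite size_block_min_words_subdiag binSn (binS r.+1 1) bin1; lia.
rewrite size_block_min_words_rec binS.
have := IHn r.+1; rewrite lt2r ltrn => /(_ isT) IH1.
(* The induction hypothesis settles the first terms of the two recurrences, so only the second terms
   remain. *)
suff: 'C(n, r) <= size (block_min_words n r) by lia.
have [lt2r'|] := ltnP 2 r; last first.
  move=> ler2; have -> : r = 2 by lia.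
  by apply/ltnW/bin2_lt_size_block_min_words; lia.
have := IHn r; rewrite lt2r' ltnW // => /(_ isT).
have : 0 < 'C(r, 2) by rewrite bin_gt0 ltnW.
lia.
Qed.

(** Passing from [k] to [k + 1] multiplies the left by [k + 1] and the right by [2 ^ k], which is no
    smaller; the strict start is 6 < 8. *)
Lemma fact_lt_expn2 r : 2 < r -> r`! < 2 ^ 'C(r, 2).
Proof.
case: r => [|[|[|r]]] // _; elim: r => // r IHr.
rewrite factS (binS r.+3 1) bin1 expnD mulnC.
apply: (@leq_trans (2 ^ 'C(r.+3, 2) * r.+4)); first by rewrite ltn_pmul2r.
by rewrite leq_mul2l; apply/orP; right; apply: ltn_expl.
Qed.

Local Open Scope group_scope.

(** * Kernels, images and ranks of products *)

Section KernelImage.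

Variable n : nat.
Implicit Types a b c g : trans n.

Definition im a : {set 'I_n} := a @: [set: 'I_n].
(** Kept as a partition rather than a relation, so that kernels of rank [r] belong to the set
    counted by [stirling2]. *)
Definition ker a : {set {set 'I_n}} := preim_partition a [set: 'I_n].

Lemma trans_mulE a b x : (a * b) x = b (a x).
Proof. by rewrite ffunE. Qed.

Lemma kerP a b : (forall x y, (a x == a y) = (b x == b y)) <-> ker a = ker b.
Proof.
split=> [eqk|eqk x y].
  by apply: eq_imset => x; apply/setP => y; rewrite !inE eqk.
have: [set z | a x == a z] \in ker b.
  by rewrite -eqk; apply/imsetP; exists x => //; apply/setP => z; rewrite !inE.
case/imsetP=> z _ /setP eqz.
have := eqz x; have := eqz y; rewrite !inE eqxx /= => -> /esym/eqP->.
by [].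
Qed.

Lemma card_ker a : #|ker a| = trans_rank a.
Proof.
have -> : ker a = [set a @^-1: [set v] | v in im a].
  rewrite -imset_comp; apply: eq_imset => x.
  by apply/setP => y; rewrite !inE eq_sym.
rewrite card_in_imset // => u v /imsetP[x _ ->] _ /setP/(_ x).
by rewrite !inE eqxx => /esym/eqP.
Qed.

Lemma ker_stirling r a : trans_rank a = r ->
  ker a \in [set P : {set {set 'I_n}} | partition P [set: 'I_n] & #|P| == r].
Proof. by move=> ra; rewrite inE card_ker ra eqxx preim_partitionP. Qed.

Lemma im_mul a b : im (a * b) = b @: im a.
Proof. by rewrite -imset_comp; apply: eq_imset => x; rewrite trans_mulE. Qed.

Lemma im_mul_sub a b : im (a * b) \subset im b.
Proof. by rewrite im_mul imsetS ?subsetT. Qed.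

Lemma rank_mull a b : trans_rank (a * b) <= trans_rank a.
Proof. by rewrite /trans_rank -/(im _) im_mul leq_imset_card. Qed.

Lemma rank_mulr a b : trans_rank (a * b) <= trans_rank b.
Proof. by rewrite subset_leq_card // im_mul_sub. Qed.

(** If the rank does not drop, [b] is injective on the image of [a] and identifies nothing new. *)
Lemma ker_mul a b : trans_rank a <= trans_rank (a * b) -> ker (a * b) = ker a.
Proof.
move=> le; have: trans_rank (a * b) == trans_rank a.
  by rewrite eqn_leq le rank_mull.
rewrite /trans_rank -/(im _) im_mul => /imset_injP injb.
apply/kerP => x y; rewrite !trans_mulE; apply/eqP/eqP => [|-> //].
by apply: injb; apply: imset_f.
Qed.

Lemma im_mulr a b : trans_rank b <= trans_rank (a * b) -> im (a * b) = im b.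
Proof. by move=> le; apply/eqP; rewrite eqEcard im_mul_sub. Qed.

(** The rank counts the kernel classes of the right factor that meet the image of the left one.
    Ranks of products are later found by comparison with a known product. *)
Lemma eq_rank_mul a a' b b' : im a = im a' -> ker b = ker b' ->
  trans_rank (a * b) = trans_rank (a' * b').
Proof.
move=> eqi /kerP eqk; rewrite [LHS]/trans_rank -/(im _) im_mul eqi -im_mul.
rewrite -[LHS]card_ker -card_ker; congr #|pred_of_set _|.
by apply/kerP => x y; rewrite !trans_mulE.
Qed.

(** [c * c'] moves each point within its kernel class of [c], which is also its class for [g]. *)
Lemma mul_reg_ker c c' g : c * c' * c = c -> ker g = ker c -> c * c' * g = g.
Proof.
move=> cc /kerP kg; apply/ffunP => x; rewrite !trans_mulE.
apply/eqP; rewrite kg.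
by rewrite -!trans_mulE mulgA cc.
Qed.

(** Dually, [d' * d] fixes the image of [d] pointwise. *)
Lemma mul_reg_im d d' g : d * d' * d = d -> im g = im d -> g * d' * d = g.
Proof.
move=> dd ig; apply/ffunP => x; rewrite !trans_mulE.
have : g x \in im d by rewrite -ig imset_f.
by case/imsetP => z _ ->; rewrite -!trans_mulE mulgA dd.
Qed.

Lemma card_im_set (J : {set trans n}) r :
  {in J, forall a, trans_rank a = r} -> #|im @: J| <= 'C(n, r).
Proof.
move=> rJ; rewrite -[X in 'C(X, _)]card_ord -card_draws subset_leq_card //.
by apply/subsetP => _ /imsetP[a aJ ->]; rewrite inE -/(trans_rank a) rJ.
Qed.

Lemma card_ker_set (J : {set trans n}) r :
  {in J, forall a, trans_rank a = r} -> #|ker @: J| <= stirling2 n r.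
Proof.
move=> rJ; rewrite subset_leq_card //.
by apply/subsetP => _ /imsetP[a aJ ->]; rewrite ker_stirling ?rJ.
Qed.

End KernelImage.

Arguments im {n} a.
Arguments ker {n} a.

(** Sending a word to the kernel of the map it encodes is injective, as the block minima can be
    recovered from the kernel. *)
Lemma size_block_min_words_stirling n r :
  (0 < n)%N -> (size (block_min_words n r) <= stirling2 n r)%N.
Proof.
case: n => // n _.
pose f (w : seq nat) : trans n.+1 := [ffun i : 'I_n.+1 => inord (nth 0%N w i)].
have fE w (i : 'I_n.+1) : w \in block_min_words n.+1 r ->
    f w i = nth 0%N w i :> nat.
  move=> /block_min_wordsP[_ _ /(_ _ (ltn_ord i))[le _]].
  by rewrite ffunE inordK // (leq_ltn_trans le).
(* [i] and [f w i] share a class, so [f w'] agrees on them, and its value at [f w i] is at most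
   [f w i]. Symmetry will give equality. *)
have kf w w' (i : 'I_n.+1) : w \in block_min_words n.+1 r ->
    w' \in block_min_words n.+1 r ->
    ker (f w) = ker (f w') -> (f w' i <= f w i)%N.
  move=> wP w'P /kerP eqk.
  have : f w (f w i) == f w i.
    rewrite -val_eqE /= !(fE w) //.
    by have [_ _ /(_ _ (ltn_ord i))[_ ->]] := block_min_wordsP wP.
  rewrite eqk => /eqP/(congr1 val) /= <-; rewrite fE //.
  by have [_ _ /(_ _ (ltn_ord (f w i)))[]] := block_min_wordsP w'P.
pose s := [seq ker (f w) | w <- block_min_words n.+1 r].
rewrite -(size_map (fun w => ker (f w))) -/s /stirling2 cardE.
apply: uniq_leq_size.
  rewrite map_inj_in_uniq ?block_min_words_uniq // => w w' wP w'P eqk.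
  have [sw _ _] := block_min_wordsP wP; have [sw' _ _] := block_min_wordsP w'P.
  apply: (@eq_from_nth _ 0%N); rewrite sw ?sw' // => i ltin.
  rewrite -[i]/(nat_of_ord (Ordinal ltin)) -!fE //.
  by apply/eqP; rewrite eqn_leq !kf.
move=> _ /mapP[w wP ->]; rewrite mem_enum ker_stirling //.
(* The image of [f w] is the set of letters of [w]. *)
have [sw <- idw] := block_min_wordsP wP.
rewrite /trans_rank -/(im _) cardE -(size_map val); apply: perm_size.
apply: uniq_perm; rewrite ?map_inj_uniq ?enum_uniq ?undup_uniq //;
  first exact: val_inj.
move=> x; rewrite mem_undup; apply/mapP/idP; last first.
  move=> xw; have lti : (index x w < n.+1)%N by rewrite -sw index_mem.
  exists (f w (Ordinal lti)); first by rewrite mem_enum imset_f.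
  by rewrite /= fE // nth_index.
case=> y; rewrite mem_enum => /imsetP[i _ ->] ->.
by rewrite /= fE // mem_nth // sw.
Qed.

(** * Generating finite cancellative semigroups *)

Section Generation.

Variable n : nat.
Implicit Types (a b c g m x y : trans n) (A H K T U X : {set trans n}).

Definition sgen A : {set trans n} :=
  \bigcap_(U : {set trans n} |
      [forall a in U, forall b in U, a * b \in U] && (A \subset U)) U.

Lemma sgen_min A U : mulg_closed U -> A \subset U -> sgen A \subset U.
Proof.
move=> cU sAU; apply: bigcap_inf; rewrite sAU andbT.
by apply/forall_inP => a aU; apply/forall_inP => b bU; apply: cU.
Qed.

Lemma sgen_closed A : mulg_closed (sgen A).
Proof.
move=> a b /bigcapP aG /bigcapP bG; apply/bigcapP => U UP.
have /andP[/forall_inP cU _] := UP.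
by have /forall_inP := cU _ (aG _ UP); apply; apply: bG.
Qed.

Lemma sub_sgen A : A \subset sgen A.
Proof. by apply/bigcapsP => U /andP[]. Qed.

Lemma setI_closed K U : mulg_closed K -> mulg_closed U -> mulg_closed (K :&: U).
Proof.
by move=> cK cU a b /setIP[? ?] /setIP[? ?]; rewrite inE cK // cU.
Qed.

(** As in Lagrange's theorem, [K] and its translate by [x] are disjoint, of equal size, and both lie
    in the larger closed set. *)
Lemma sgen_doubles (H K : {set trans n}) x :
    {in H & &, forall a x y, a * x = a * y -> x = y} ->
    {in H & &, forall a x y, x * a = y * a -> x = y} ->
    mulg_closed K -> K \subset H -> x \in H -> x \notin K ->
  (#|K| * 2 <= #|sgen (x |: K)|)%N.
Proof.
move=> lcan rcan cK sKH xH xK; set K' := sgen _.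
have sK' : x |: K \subset K' by exact: sub_sgen.
have sKK' : K \subset K' by apply: subset_trans sK'; apply: subsetUr.
have xK' : x \in K' by apply: (subsetP sK'); rewrite setU11.
have dis : [disjoint K & [set k * x | k : trans n in K]].
  apply/pred0P => y /=; apply/andP => -[yK /imsetP[k kK yE]].
  (* By finiteness, left multiplication by [k] permutes [K]; so [k * x] in [K] equals some [k * z],
     and cancelling puts [x] in [K]. *)
  have eK : [set k * z | z : trans n in K] = K.
    apply/eqP; rewrite eqEcard; apply/andP; split.
      by apply/subsetP => _ /imsetP[z zK ->]; apply: cK.
    rewrite card_in_imset // => u v uK vK.
    by apply: lcan; apply: (subsetP sKH).
  move: yK; rewrite -eK => /imsetP[z zK]; rewrite yE => kE.
  have xz := lcan _ _ _ (subsetP sKH _ kK) xH (subsetP sKH _ zK) kE.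
  by rewrite xz zK in xK.
have cKx : #|[set k * x | k : trans n in K]| = #|K|.
  rewrite card_in_imset // => u v uK vK.
  by apply: rcan => //; apply: (subsetP sKH).
have -> : (#|K| * 2)%N = #|K :|: [set k * x | k : trans n in K]|.
  rewrite cardsU (eqP (_ : #|_ :&: _| == 0%N)); first by rewrite cKx; lia.
  by rewrite cards_eq0 setI_eq0.
rewrite subset_leq_card // subUset sKK'.
apply/subsetP => _ /imsetP[k kK ->]; apply: sgen_closed => //.
exact: (subsetP sKK').
Qed.

(** Every new generator at least doubles the closed set reached so far, and [H] has no room for
    [d.+1] doublings of [K]. *)
Lemma gens_leq_log (H K : {set trans n}) d :
    mulg_closed H ->
    {in H & &, forall a x y, a * x = a * y -> x = y} ->
    {in H & &, forall a x y, x * a = y * a -> x = y} ->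
    mulg_closed K -> K \subset H -> (#|H| < #|K| * 2 ^ d.+1)%N ->
  exists2 X : {set trans n}, (#|X| <= d)%N /\ X \subset H
    & forall T, mulg_closed T -> K \subset T -> X \subset T -> H \subset T.
Proof.
move=> cH lcan rcan; elim: d K => [|d IHd] K cK sKH ltHK;
  have [sHK|/subsetPn[x xH xK]] := boolP (H \subset K); try by
    exists set0 => [|T _ sKT _]; rewrite ?cards0 ?sub0set // (subset_trans sHK).
all: have le2 := sgen_doubles lcan rcan cK sKH xH xK.
all: have sK'H : sgen (x |: K) \subset H
       by apply: sgen_min; rewrite // subUset sub1set xH.
  (* For [d = 0], a single doubling already exceeds the size of [H]. *)
  have := leq_trans ltHK le2; rewrite ltnNge subset_leq_card //.
have {}ltHK : (#|H| < #|sgen (x |: K)| * 2 ^ d.+1)%N.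
  by apply: (leq_trans ltHK); rewrite (expnS _ d.+1) mulnA leq_mul2r le2 orbT.
have [X [cX sX] XP] := IHd _ (@sgen_closed _) sK'H ltHK.
exists (x |: X) => [|T cT sKT]; last first.
  rewrite subUset sub1set => /andP[xT sXT]; apply: XP => //.
  by apply: sgen_min => //; rewrite subUset sub1set xT.
rewrite subUset sub1set xH sX; split=> //.
by apply: (leq_trans (leq_card_setU _ _)); rewrite cards1 ltnS.
Qed.

(** * Elements sharing kernel and image with a group element *)

Section GroupHclass.

Variables (m : trans n) (H : {set trans n}).
Hypothesis mm : trans_rank (m * m) = trans_rank m.
Hypothesis HP : forall g, g \in H -> ker g = ker m /\ im g = im m.

(** Since [m * m] has the image of [m], this image meets every kernel class, so a map with that
    kernel is determined on it. *)
Lemma Hclass_ext a b : ker a = ker m -> ker b = ker m ->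
  {in im m, a =1 b} -> a = b.
Proof.
move=> /kerP ka /kerP kb eqab; apply/ffunP => x.
have : m x \in im (m * m).
  by rewrite im_mulr ?imset_f // mm.
case/imsetP => y _; rewrite trans_mulE => /eqP mxy.
have mym : m y \in im m by rewrite imset_f.
have /eqP -> : a x == a (m y) by rewrite ka.
have /eqP -> : b x == b (m y) by rewrite kb.
exact: eqab.
Qed.

Lemma Hclass_inj g : g \in H -> {in im m &, injective g}.
Proof.
move=> /HP[kg _]; have : trans_rank (m * g) = trans_rank m.
  by rewrite (@eq_rank_mul _ m m g m).
by rewrite [LHS]/trans_rank -/(im _) im_mul => /eqP/imset_injP.
Qed.

Lemma Hclass_lcancel : {in H & &, forall a x y, a * x = a * y -> x = y}.
Proof.
move=> a x y aH xH yH axy.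
have [[_ ia] [kx _] [ky _]] := And3 (HP aH) (HP xH) (HP yH).
apply: Hclass_ext => // z; rewrite -ia => /imsetP[w _ ->].
by rewrite -!trans_mulE axy.
Qed.

Lemma Hclass_rcancel : {in H & &, forall a x y, x * a = y * a -> x = y}.
Proof.
move=> a x y aH xH yH xya; have [[_ ix] [_ iy]] := (HP xH, HP yH).
apply/ffunP => z; apply: (Hclass_inj aH); last by rewrite -!trans_mulE xya.
  by rewrite -ix imset_f.
by rewrite -iy imset_f.
Qed.

(** Restriction to the image of [m] embeds [H] into the permutations of that image. *)
Lemma card_Hclass : (#|H| <= (trans_rank m)`!)%N.
Proof.
pose D := {x : 'I_n | x \in im m}.
pose f g : {ffun D -> 'I_n} := [ffun x => g (val x)].
have cD : #|{: D}| = trans_rank m by rewrite card_sig.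
rewrite -ffactnn -[X in _ ^_ X]cD -(card_inj_ffuns_on D (mem (im m))).
have fH : {in H &, injective f}.
  move=> a b /HP[ka _] /HP[kb _] /ffunP fab; apply: Hclass_ext => // x xm.
  by have := fab (exist _ x xm); rewrite !ffunE.
rewrite -(card_in_imset fH) subset_leq_card //.
apply/subsetP => _ /imsetP[g gH ->]; rewrite inE; apply/andP; split.
  apply/ffun_onP => x; rewrite ffunE; have [_ ig] := HP gH.
  have : g (val x) \in im g by exact: imset_f.
  by rewrite ig.
apply/injectiveP => x y; rewrite !ffunE => gxy; apply: val_inj.
by apply: (Hclass_inj gH _ _ gxy); apply: (valP _).
Qed.

End GroupHclass.

End Generation.

(** * Generating the elements of rank [r] *)

Section TopJclass.

Variables (n r : nat) (S : {set trans n}).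
Hypothesis clS : mulg_closed S.
Hypothesis regS : regular S.
Implicit Types (a b c d g m u v x y : trans n) (U : {set trans n}).

Let J := [set a in S | trans_rank a == r].

(** Of the uniqueness of the maximal J-class, this section uses only this full rectangle of kernels
    and images. *)
Hypothesis rectJ : {in J &, forall a b,
  exists2 c, c \in J & ker c = ker a /\ im c = im b}.

Let JP a : a \in J -> a \in S /\ trans_rank a = r.
Proof. by rewrite inE => /andP[-> /eqP]. Qed.

Lemma ker_mulJ a b : a \in J -> trans_rank (a * b) = r ->
  ker (a * b) = ker a.
Proof. by move=> /JP[_ ra] rab; apply: ker_mul; rewrite ra rab. Qed.

Lemma im_mulJ a b : b \in J -> trans_rank (a * b) = r ->
  im (a * b) = im b.
Proof. by move=> /JP[_ rb] rab; apply: im_mulr; rewrite rb rab. Qed.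

Lemma mulJ a b : a \in J -> b \in J -> trans_rank (a * b) = r ->
  [/\ a * b \in J, ker (a * b) = ker a & im (a * b) = im b].
Proof.
move=> aJ bJ rab; have [[aS _] [bS _]] := (JP aJ, JP bJ).
by rewrite inE clS //= rab eqxx ker_mulJ ?im_mulJ.
Qed.

(* With [c = a * x0] and [d = x0 * b], the solution is [x0 * c' * g * d' * x0],
   where [c'] and [d'] are generalized inverses of [c] and [d]. *)
Lemma solve_sandwich a b g x0 :
    a \in J -> b \in J -> g \in J -> x0 \in J ->
    trans_rank (a * x0) = r -> trans_rank (x0 * b) = r ->
    ker g = ker a -> im g = im b ->
  exists2 x, x \in J & [/\ ker x = ker x0, im x = im x0 & a * x * b = g].
Proof.
move=> aJ bJ gJ x0J rax rxb kg ig.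
have [cJ kc _] := mulJ aJ x0J rax; have [dJ _ id] := mulJ x0J bJ rxb.
have [[cS _] [dS _] [gS rg] [xS rx]] := And4 (JP cJ) (JP dJ) (JP gJ) (JP x0J).
have [c' c'S cc] := regS cS; have [d' d'S dd] := regS dS.
pose x := x0 * (c' * g * d') * x0.
have eg : a * x * b = g.
  have -> : a * x * b = a * x0 * c' * g * d' * (x0 * b) by rewrite /x !mulgA.
  by rewrite (mul_reg_ker cc) ?(mul_reg_im dd) ?kg ?kc ?id ?ig.
have lex : (r <= trans_rank x)%N.
  by rewrite -rg -eg; apply: leq_trans (rank_mull _ _) (rank_mulr _ _).
have xS' : x \in S by rewrite /x !clS.
have rxr : trans_rank x = r.
  by apply/eqP; rewrite eqn_leq lex andbT -rx; apply: rank_mulr.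
exists x; first by rewrite inE xS' rxr eqxx.
split=> //; last by apply: im_mulr; rewrite rx -/x.
by rewrite /x -mulgA ker_mul // mulgA -/x rx.
Qed.

(** Squaring keeps the rank exactly when the image is a transversal of the kernel, that is, when the
    H-class of [m] is a group. *)
Definition group_Helt m := (m \in J) && (trans_rank (m * m) == r).

(** If [x] is a generalized inverse of [v], then [v * x] is an idempotent with the kernel of [v];
    dually, [x * v] has its image. *)
Lemma exists_group_ker v : v \in J -> exists2 m, group_Helt m & ker m = ker v.
Proof.
move=> vJ; have [vS rv] := JP vJ; have [x xS vxv] := regS vS.
have rvx : trans_rank (v * x) = r.
  apply/eqP; rewrite eqn_leq -rv rank_mull -{1}vxv rank_mull //.
exists (v * x); last exact: ker_mulJ.
by rewrite /group_Helt inE clS //= rvx mulgA vxv rvx eqxx.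
Qed.

Lemma exists_group_im v : v \in J -> exists2 m, group_Helt m & im m = im v.
Proof.
move=> vJ; have [vS rv] := JP vJ; have [x xS vxv] := regS vS.
have rxv : trans_rank (x * v) = r.
  apply/eqP; rewrite eqn_leq -rv rank_mulr -{1}vxv -mulgA rank_mulr //.
exists (x * v); last exact: im_mulJ.
by rewrite /group_Helt inE clS //= rxv -mulgA (mulgA v) vxv rxv eqxx.
Qed.

(** A matching in the bipartite graph of kernels and images, whose edges are the group H-classes. *)
Definition matching (M : {set trans n}) :=
  (M \subset [set m | group_Helt m]) &&
  [forall a in M, forall b in M,
    ((ker a == ker b) || (im a == im b)) ==> (a == b)].

(** Maximality is for inclusion: a group element sharing neither kernel nor image with [M] could be
    added. *)
Lemma exists_maximal_matching : exists M : {set trans n},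
  [/\ {in M, forall m, group_Helt m}, {in M &, injective ker},
      {in M &, injective im} &
      forall m, group_Helt m -> (ker m \in ker @: M) || (im m \in im @: M)].
Proof.
have P0 : matching set0.
  by rewrite /matching sub0set; apply/forall_inP => a; rewrite inE.
have [M /maxsetP[/andP[sM /forall_inP injM] maxM] _] := maxset_exists P0.
have eM a b : a \in M -> b \in M -> (ker a == ker b) || (im a == im b) -> a = b.
  by move=> aM bM; have /forall_inP/(_ b bM)/implyP h := injM _ aM; move/h/eqP.
exists M; split=> [m mM|a b aM bM eab|a b aM bM eab|m mH].
- by have := subsetP sM _ mM; rewrite inE.
- by apply: eM; rewrite // eab eqxx.
- by apply: eM; rewrite // eab eqxx orbT.
have [|/norP[nk ni]] := boolP (_ || _) => //.
suff mMM : m |: M = M.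
  by case/negP: nk; apply: imset_f; rewrite -mMM setU11.
apply: maxM; last exact: subsetUr.
rewrite /matching subUset sub1set inE mH sM /=.
have nkm b : b \in M -> (ker m == ker b) || (im m == im b) = false.
  move=> bM; apply/negbTE/norP; split; apply/eqP => e.
    by case/negP: nk; rewrite e imset_f.
  by case/negP: ni; rewrite e imset_f.
apply/forall_inP => a /setU1P[->|aM]; apply/forall_inP => b /setU1P[->|bM].
- by apply/implyP.
- by rewrite nkm.
- by rewrite eq_sym [im _ == _]eq_sym nkm.
- by apply/implyP => /eM->.
Qed.

(** By [rectJ], the default [a] is never reached for arguments in [J]. *)
Definition Helt a b :=
  odflt a [pick c in J | (ker c == ker a) && (im c == im b)].

Lemma HeltP a b : a \in J -> b \in J ->
  [/\ Helt a b \in J, ker (Helt a b) = ker a & im (Helt a b) = im b].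
Proof.
move=> aJ bJ; rewrite /Helt; case: pickP => [c /and3P[? /eqP ? /eqP ?] //|no].
by have [c cJ [kc ic]] := rectJ aJ bJ; have := no c; rewrite cJ kc ic !eqxx.
Qed.

(** Applied to both [ker] and [im]: indexing the unmatched values by [t < q] lets one generator
    serve the [t]-th kernel and the [t]-th image together. *)
Lemma exists_reps (T : finType) (f : trans n -> T) (M : {set trans n}) q a0 :
    M \subset J -> {in M &, injective f} -> a0 \in J ->
    (#|f @: J| <= #|M| + q)%N ->
  exists2 s : seq (trans n), {subset s <= J} & forall a, a \in J ->
    f a \in f @: M \/ exists2 t, (t < q)%N & f (nth a0 s t) = f a.
Proof.
move=> sMJ injM a0J leq.
pose V := f @: J :\: f @: M.
pose rep (i : T) := odflt a0 [pick c in J | f c == i].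
have repP i : i \in f @: J -> rep i \in J /\ f (rep i) = i.
  case/imsetP=> a aJ ->; rewrite /rep; case: pickP => [c /andP[? /eqP] //|no].
  by have := no a; rewrite aJ eqxx.
have sz : (size [seq rep i | i <- enum V] <= q)%N.
  rewrite size_map -cardE /V cardsD.
  have -> : f @: J :&: f @: M = f @: M by apply/setIidPr/imsetS.
  by rewrite (card_in_imset injM); lia.
exists [seq rep i | i <- enum V] => [x|a aJ].
  by case/mapP=> i; rewrite mem_enum => /setDP[/repP[? _] _] ->.
have [|faM] := boolP (f a \in f @: M); [by left|right].
have faV : f a \in enum V by rewrite mem_enum inE faM imset_f.
exists (index (f a) (enum V)).
  by apply: leq_trans sz; rewrite size_map index_mem.
rewrite (nth_map (f a)) ?index_mem // nth_index //.
by have [] := repP (f a) (imset_f _ aJ).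
Qed.

(** Consecutive factors meet at the image and kernel of a group element [m k], so their product
    keeps rank [r]. *)
Lemma mul_chain U (c : nat -> trans n) (m : nat -> trans n) :
    mulg_closed U -> (forall k, c k \in U) ->
    (forall k, group_Helt (m k)) ->
    (forall k, [/\ c k \in J, ker (c k) = ker (m k) & im (c k) = im (m k.+1)]) ->
  forall s k, exists2 x, x \in U &
    [/\ x \in J, ker x = ker (m s) & im x = im (m (s + k).+1)].
Proof.
move=> clU cU mH cP s; elim=> [|k [x xU [xJ kx ix]]].
  by exists (c s) => //; rewrite addn0; apply: cP.
have [cJ kc ic] := cP (s + k).+1.
have /andP[mJ /eqP mm] := mH (s + k).+1.
have rxc : trans_rank (x * c (s + k).+1) = r.
  by rewrite -mm; apply: eq_rank_mul.
have [xcJ kxc ixc] := mulJ xJ cJ rxc.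
exists (x * c (s + k).+1); first exact: clU.
by rewrite kxc ixc addnS.
Qed.

(** As [p] is at most the number of images, the second bound leaves at least [rho] generators beyond
    the cycle, enough for the group. *)
Lemma generators_of_J N rho : (exists a, a \in J) ->
    (#|ker @: J| <= N)%N -> (#|im @: J| + rho <= N)%N -> (r`! < 2 ^ rho.+1)%N ->
  exists B : {set trans n}, [/\ (#|B| <= N)%N, B \subset J &
    forall U, mulg_closed U -> B \subset U -> J \subset U].
Proof.
move=> [a0 a0J] leI leL ler.
have [M [MH kM iM maxM]] := exists_maximal_matching.
have sMJ : M \subset J by apply/subsetP => m /MH/andP[].
(* [M] meets the kernel or the image of a group element [e] with the kernel of [v]; then [m * v] has
   the rank of [m * m] or of [e * e]. *)
have outM v : v \in J -> exists2 m, m \in M & trans_rank (m * v) = r.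
  move=> vJ; have [e eH ke] := exists_group_ker vJ.
  have /andP[eJ /eqP ree] := eH.
  case/orP: (maxM _ eH) => /imsetP[m mM em]; exists m => //.
    have /andP[_ /eqP <-] := MH _ mM.
    by apply: eq_rank_mul; rewrite // -em ke.
  by rewrite -ree; apply: eq_rank_mul.
have inM v : v \in J -> exists2 m, m \in M & trans_rank (v * m) = r.
  move=> vJ; have [e eH ie] := exists_group_im vJ.
  have /andP[eJ /eqP ree] := eH.
  case/orP: (maxM _ eH) => /imsetP[m mM em]; exists m => //.
    by rewrite -ree; apply: eq_rank_mul.
  have /andP[_ /eqP <-] := MH _ mM.
  by apply: eq_rank_mul; rewrite // -em ie.
have [m0 m0M _] := outM _ a0J.
set p := #|M|; have p_gt0 : (0 < p)%N by apply/card_gt0P; exists m0.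
have leML : (p <= #|im @: J|)%N.
  by rewrite /p -(card_in_imset iM) subset_leq_card ?imsetS.
(* [M] is enumerated with period [p], so that the successor in the cycle is simply [k.+1]. *)
pose mu k := nth m0 (enum M) (k %% p).
have ltp k : (k %% p < size (enum M))%N by rewrite -cardE ltn_mod.
have muM k : mu k \in M by rewrite -mem_enum mem_nth.
have muH k : group_Helt (mu k) by exact: MH.
have muJ k : mu k \in J by apply: (subsetP sMJ).
have muP m : m \in M -> exists2 s, (s < p)%N & mu s = m.
  rewrite -mem_enum => mM; have := mM; rewrite -index_mem -cardE => lts.
  by exists (index m (enum M)); rewrite // /mu modn_small // nth_index.
pose c k := Helt (mu k) (mu k.+1).
have cP k : [/\ c k \in J, ker (c k) = ker (mu k) & im (c k) = im (mu k.+1)].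
  exact: HeltP.
pose C := [set c (val k) | k : 'I_p].
have cC k : c k \in C.
  have -> : c k = c (k %% p).
    by rewrite /c /mu modn_mod -[in RHS]addn1 modnDml addn1.
  by apply/imsetP; exists (Ordinal (ltn_pmod k p_gt0)).
have CJ : C \subset J by apply/subsetP => _ /imsetP[k _ ->]; have [] := cP k.
have link U m m' : mulg_closed U -> C \subset U -> m \in M -> m' \in M ->
    exists2 x, x \in U & [/\ x \in J, ker x = ker m & im x = im m'].
  move=> clU CU /muP[s lts <-] /muP[s' lts' <-].
  have cU k : c k \in U by apply: (subsetP CU).
  (* Walking from [s] to [s' + p] uses at least one factor since [s < p]; [mul_chain] takes the
     number of factors minus one. *)
  have [x xU] := mul_chain clU cU muH cP s (s' + p - s).-1.
  have -> : (s + (s' + p - s).-1).+1 = (s' + p)%N by lia.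
  by rewrite {2}/mu modnDr; exists x.
have m0J := subsetP sMJ _ m0M.
have /andP[_ /eqP mm0] := MH _ m0M; have [_ rm0] := JP m0J.
pose H := [set g in J | (ker g == ker m0) && (im g == im m0)].
have HP g : g \in H -> ker g = ker m0 /\ im g = im m0.
  by rewrite !inE => /andP[_ /andP[/eqP-> /eqP->]].
have HJ g : g \in H -> g \in J by rewrite inE => /andP[].
have mm0' : trans_rank (m0 * m0) = trans_rank m0 by rewrite mm0.
have clH : mulg_closed H.
  move=> a b aH bH; have [[ka ia] [kb ib]] := (HP _ aH, HP _ bH).
  have rab : trans_rank (a * b) = r by rewrite -mm0; apply: eq_rank_mul.
  have [abJ kab iab] := mulJ (HJ _ aH) (HJ _ bH) rab.
  by rewrite inE abJ kab iab ka ib !eqxx.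
have clG := @sgen_closed _ C; have sG := sub_sgen C.
(* The part of the group [H] that the cycle alone generates; the closed walk at [m0] makes it
   nonempty. *)
pose K := sgen C :&: H.
have K_gt0 : (0 < #|K|)%N.
  have [x xG [xJ kx ix]] := link _ _ _ clG sG m0M m0M.
  by apply/card_gt0P; exists x; apply/setIP; split; rewrite // inE xJ kx ix !eqxx.
pose q := (N - p)%N.
have leq_rho : (rho <= q)%N by rewrite /q; lia.
have ltHK : (#|H| < #|K| * 2 ^ rho.+1)%N.
  apply: leq_ltn_trans (card_Hclass mm0' HP) _; rewrite rm0.
  by apply: (leq_trans ler); rewrite leq_pmull.
have clK : mulg_closed K by exact: setI_closed.
have [X [cX sXH] XP] := gens_leq_log clH (Hclass_lcancel mm0' HP)
  (Hclass_rcancel mm0' HP) clK (subsetIr _ _) ltHK.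
(* Past the end of the list the default [m0] still lies in [H]; it pads the lists of kernels and
   images below in the same way. *)
pose g t := nth m0 (enum X) t.
have m0H : m0 \in H by rewrite inE m0J !eqxx.
have gH t : g t \in H.
  rewrite /g; have [lt|le] := ltnP t (size (enum X));
    last by rewrite nth_default.
  by apply: (subsetP sXH); rewrite -mem_enum mem_nth.
have [|vs vsJ vsP] := @exists_reps _ (@ker n) M q m0 sMJ kM m0J.
  by rewrite -/p /q; lia.
have [|us usJ usP] := @exists_reps _ (@im n) M q m0 sMJ iM m0J.
  by rewrite -/p /q; lia.
pose v t := nth m0 vs t; pose u t := nth m0 us t.
have vJ t : v t \in J.
  rewrite /v; have [lt|le] := ltnP t (size vs); last by rewrite nth_default.
  by apply: vsJ; rewrite mem_nth.
have uJ t : u t \in J.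
  rewrite /u; have [lt|le] := ltnP t (size us); last by rewrite nth_default.
  by apply: usJ; rewrite mem_nth.
(* The inserted generator has the [t]-th unmatched kernel and image, and its group component is
   chosen so that a detour through it, entered and left along the cycle, equals [g t]. *)
have dP t : exists d, [&& d \in J, ker d == ker (v t), im d == im (u t) &
    [exists x in sgen C, exists y in sgen C,
      [&& ker x == ker m0, x \in J, y \in J, im y == im m0,
          trans_rank (x * d) == r, trans_rank (d * y) == r & x * d * y == g t]]].
  have [mv mvM rv] := outM _ (vJ t); have [mu' muM' ru] := inM _ (uJ t).
  have [x xG [xJ kx ix]] := link _ _ _ clG sG m0M mvM.
  have [y yG [yJ ky iy]] := link _ _ _ clG sG muM' m0M.
  have [hJ kh ih] := HeltP (vJ t) (uJ t).
  have [kg ig] := HP _ (gH t).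
  have rxh : trans_rank (x * Helt (v t) (u t)) = r.
    by rewrite -rv; apply: eq_rank_mul.
  have rhy : trans_rank (Helt (v t) (u t) * y) = r.
    by rewrite -ru; apply: eq_rank_mul.
  have [||d dJ [kd id xdy]] := solve_sandwich xJ yJ (HJ _ (gH t)) hJ rxh rhy.
  - by rewrite kg kx.
  - by rewrite ig iy.
  exists d; rewrite dJ kd id kh ih !eqxx /=.
  apply/exists_inP; exists x => //; apply/exists_inP; exists y => //.
  rewrite kx iy xJ yJ xdy !eqxx /= andbT; apply/andP; split; apply/eqP.
    by rewrite -rxh; apply: eq_rank_mul.
  by rewrite -rhy; apply: eq_rank_mul.
pose d t := xchoose (dP t).
pose D := [set d (val t) | t : 'I_q].
exists (C :|: D); split.
- apply: (leq_trans (leq_card_setU _ _)).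
  have leC : (#|C| <= p)%N by rewrite -[p]card_ord leq_imset_card.
  have leD : (#|D| <= q)%N by rewrite -[q]card_ord leq_imset_card.
  apply: leq_trans (leq_add leC leD) _; rewrite subnKC //.
  exact: leq_trans leML (leq_trans (leq_addr _ _) leL).
- rewrite subUset CJ; apply/subsetP => _ /imsetP[t _ ->].
  by have /and4P[] := xchooseP (dP (val t)).
move=> U clU; rewrite subUset => /andP[sCU sDU].
have sGU : sgen C \subset U by exact: sgen_min.
have dU t : (t < q)%N -> d t \in U.
  by move=> lt; apply: (subsetP sDU); apply/imsetP; exists (Ordinal lt).
(* Each extra group generator in [X] is some [g t] with [t < q], hence a detour through [d t]. *)
have sHU : H \subset U.
  apply: XP => //; first exact: subset_trans (subsetIl _ _) sGU.
  apply/subsetP => z; rewrite -mem_enum => zX.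
  have lt : (index z (enum X) < q)%N.
    by apply: leq_trans leq_rho; apply: leq_trans cX; rewrite cardE index_mem.
  have /and4P[_ _ _ /exists_inP[x xG /exists_inP[y yG]]] :=
    xchooseP (dP (index z (enum X))).
  case/and4P=> _ _ _ /and4P[_ _ _ /eqP].
  rewrite {2}/g nth_index // => <-.
  by apply: (clU); [apply: (clU)|];
    [exact: (subsetP sGU)|exact: dU|exact: (subsetP sGU)].
have toM0 a : a \in J ->
    exists2 x, x \in U & [/\ x \in J, ker x = ker a & im x = im m0].
  move=> aJ; have [/imsetP[m mM ->]|[t lt <-]] := vsP _ aJ; first exact: link.
  have /and4P[dJ /eqP kd _ /exists_inP[x xG /exists_inP[y yG]]] := xchooseP (dP t).
  case/and4P=> _ _ yJ /and4P[/eqP iy _ /eqP rdy _].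
  have [dyJ kdy idy] := mulJ dJ yJ rdy.
  exists (d t * y); first by apply: clU; [exact: dU|exact: (subsetP sGU)].
  by split; rewrite ?kdy ?idy.
have fromM0 a : a \in J ->
    exists2 x, x \in U & [/\ x \in J, ker x = ker m0 & im x = im a].
  move=> aJ; have [/imsetP[m mM ->]|[t lt <-]] := usP _ aJ; first exact: link.
  have /and4P[dJ _ /eqP id /exists_inP[x xG /exists_inP[y yG]]] := xchooseP (dP t).
  case/and4P=> /eqP kx xJ _ /and4P[_ /eqP rxd _ _].
  have [xdJ kxd ixd] := mulJ xJ dJ rxd.
  exists (x * d t); first by apply: clU; [exact: (subsetP sGU)|exact: dU].
  by split; rewrite ?kxd ?ixd.
apply/subsetP => a aJ.
have [x xU [xJ kx ix]] := toM0 _ aJ; have [y yU [yJ ky iy]] := fromM0 _ aJ.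
have rxm : trans_rank (x * m0) = r by rewrite -mm0; apply: eq_rank_mul.
have rmy : trans_rank (m0 * y) = r by rewrite -mm0; apply: eq_rank_mul.
(* With [m0] as the middle pattern, [a] factors through an element [h] of the group. *)
have [h hJ [kh ih <-]] := solve_sandwich xJ yJ aJ m0J rxm rmy (esym kx) (esym iy).
have hU : h \in U by apply: (subsetP sHU); rewrite inE hJ kh ih !eqxx.
by apply: (clU) => //; apply: clU.
Qed.

End TopJclass.

(** [rho] bounds the integer part of the binary logarithm of [r!]. The choice ['C(r, 2) - 1] would
    be 0 at [r = 2], which is too small, so 1 is taken there. *)
Lemma stirling2_bin_bound n r : 4 <= n -> 1 < r < n ->
  exists2 rho, r`! < 2 ^ rho.+1 & 'C(n, r) + rho <= stirling2 n r.
Proof.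
move=> le4n /andP[lt1r ltrn].
have leS := @size_block_min_words_stirling n r (leq_trans _ le4n).
have [lt2r|le2r] := ltnP 2 r.
  exists ('C(r, 2)).-1.
    by rewrite prednK ?fact_lt_expn2 // bin_gt0.
  have := @bin_leq_size_block_min_words n r; rewrite lt2r ltrn => /(_ isT).
  have := leS isT; have : (0 < 'C(r, 2))%N by rewrite bin_gt0.
  lia.
have r2 : r = 2 by apply/eqP; rewrite eqn_leq le2r.
subst r; exists 1%N => //; rewrite addn1.
exact: leq_trans (bin2_lt_size_block_min_words le4n) (leS isT).
Qed.

(** * Consequences of a unique maximal J-class *)

Section UniqueMaximalJclass.

Variables (n : nat) (S : {set trans n}).
Implicit Types (a b c g m x y : trans n).

Lemma pidealP a b : b \in pideal S a ->
  [\/ b = a, exists2 x, x \in S & b = x * a, exists2 y, y \in S & b = a * y |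
      exists x y, [/\ x \in S, y \in S & b = x * a * y]].
Proof.
rewrite !inE -!orbA => /or4P[/eqP->|/imsetP[x xS ->]|/imsetP[y yS ->]|].
- by constructor 1.
- by constructor 2; exists x.
- by constructor 3; exists y.
- by case/imset2P=> x y xS yS ->; constructor 4; exists x, y.
Qed.

Lemma mem_pideal a : a \in pideal S a.
Proof. by rewrite !inE eqxx. Qed.

(** By finiteness, each element lies below one with the largest principal ideal, whose class is
    maximal and so is the unique one. *)
Lemma unique_maximal_top :
    (exists! J : {set trans n}, maximal_Jclass S J) ->
  exists2 m, m \in S & {in S, forall a, a \in pideal S m}.
Proof.
case=> Jm [[/imsetP[m mS ->] _] uniqJ]; exists m => // a aS.
pose P b := (b \in S) && (pideal S a \subset pideal S b).
have Pa : P a by rewrite /P aS subxx.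
case: (arg_maxnP (fun b => #|pideal S b|) Pa) => b /andP[bS sab] bmax.
have maxb : maximal_Jclass S (Jclass S b).
  split=> [|_ /imsetP[k kS ->] [x [y [xb yk sxy]]]]; first exact: imset_f.
  move: xb yk sxy; rewrite !inE => /andP[_ /eqP->] /andP[_ /eqP->] sbk.
  have /eqP ebk : pideal S b == pideal S k.
    rewrite eqEcard sbk; apply: bmax.
    by rewrite /P kS (subset_trans sab).
  by apply/setP => z; rewrite !inE ebk.
have : b \in Jclass S m by rewrite (uniqJ _ maxb) inE bS eqxx.
rewrite inE => /andP[_ /eqP<-].
exact: (subsetP sab) (mem_pideal a).
Qed.

(** A factorization of a rank [r] element through the top element [m] yields elements joining its
    kernel to the image of [m], and the kernel of [m] to its image. *)
Lemma top_rectangular r : mulg_closed S -> regular S ->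
    {in S, forall a, trans_rank a <= r} ->
    (exists2 g, g \in S & trans_rank g = r) ->
    (exists! J : {set trans n}, maximal_Jclass S J) ->
  {in [set a in S | trans_rank a == r] &, forall a b,
    exists2 c, c \in [set a in S | trans_rank a == r]
             & ker c = ker a /\ im c = im b}.
Proof.
move=> clS regS leS [g gS rg] /unique_maximal_top[m mS topm].
have rm : trans_rank m = r.
  apply/eqP; rewrite eqn_leq leS //= -rg.
  case/pidealP: (topm _ gS) => [->|[x _ ->]|[y _ ->]|[x [y [_ _ ->]]]] //.
  - exact: rank_mulr.
  - exact: rank_mull.
  - exact: leq_trans (rank_mull _ _) (rank_mulr _ _).
have factor a : a \in S -> trans_rank a = r ->
    (exists2 c, c \in S & [/\ trans_rank c = r, ker c = ker a & im c = im m]) /\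
    (exists2 c, c \in S & [/\ trans_rank c = r, ker c = ker m & im c = im a]).
  move=> aS ra.
  case/pidealP: (topm _ aS) => [aE|[x xS aE]|[y yS aE]|[x [y [xS yS aE]]]].
  - by split; exists m; rewrite // aE.
  - split; last by exists m => //; split; rewrite // aE im_mulr // -aE ra rm.
    by exists a => //; split; rewrite // aE im_mulr // -aE ra rm.
  - split; first by exists m => //; split; rewrite // aE ker_mul // -aE ra rm.
    by exists a => //; split; rewrite // aE ker_mul // -aE ra rm.
  - have rxm : trans_rank (x * m) = r.
      by apply/eqP; rewrite eqn_leq leS ?clS // -ra aE rank_mull.
    have rmy : trans_rank (m * y) = r.
      by apply/eqP; rewrite eqn_leq leS ?clS // -ra aE -mulgA rank_mulr.
    split.
      exists (x * m); first exact: clS.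
      split=> //; last by rewrite im_mulr // rxm rm.
      by rewrite aE (ker_mul (a := x * m)) // -aE ra rxm.
    exists (m * y); first exact: clS.
    split=> //; first by rewrite ker_mul // rmy rm.
    by rewrite aE -mulgA (im_mulr (b := m * y)) // mulgA -aE ra rmy.
move=> a b; rewrite !inE => /andP[aS /eqP ra] /andP[bS /eqP rb].
have [[c cS [rc kc ic]] _] := factor a aS ra.
have [_ [d dS [rd kd id]]] := factor b bS rb.
have [z zS mzm] := regS _ mS.
(* The rank is that of [m * z * m], as [c] has the image of [m] and [d] its kernel. *)
have rczd : trans_rank (c * z * d) = r.
  rewrite -mulgA (@eq_rank_mul _ c m (z * d) (z * m)) ?mulgA ?mzm //.
  by apply/kerP => x y; rewrite !trans_mulE; move/kerP: kd => ->.
exists (c * z * d); first by rewrite inE rczd !clS /=.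
rewrite -kc -id; split; last by rewrite im_mulr // rczd rd.
by rewrite -mulgA ker_mul // mulgA rczd rc.
Qed.

End UniqueMaximalJclass.

Theorem theorem18 (n r : nat) (hn : 4 <= n) (hr : 1 < r < n)
    (S : {set trans n}) (subS : subsemigroup S) (regS : regular S)
    (genS : exists A : {set trans n},
        (forall a, a \in A -> trans_rank a = r) /\ generates A S)
    (maxS : exists! J : {set trans n}, maximal_Jclass S J) :
  exists B : {set trans n}, #|B| <= stirling2 n r /\ generates B S.
Proof.
case: genS => A [rA [clS sAS minS]].
have leS : {in S, forall a, trans_rank a <= r}.
  have sub : S \subset [set a | trans_rank a <= r].
    apply: minS => [a b|]; last by apply/subsetP => a /rA ra; rewrite inE ra.
    by rewrite !inE => lea _; apply: leq_trans (rank_mull _ _) lea.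
  by move=> a /(subsetP sub); rewrite inE.
(* If [A] were empty, the empty set would be a closed set containing it, forcing [S] to be empty. *)
have [g gA] : exists g, g \in A.
  apply/set0Pn/eqP => A0; case: subS => /negP nS _; apply: nS; rewrite -subset0.
  by apply: minS; rewrite ?A0 // => a b; rewrite inE.
have gS := subsetP sAS _ gA.
have rectJ := top_rectangular clS regS leS (ex_intro2 _ _ g gS (rA _ gA)) maxS.
have [rho ltr leN] := stirling2_bin_bound hn hr.
set J := [set a in S | trans_rank a == r] in rectJ.
have JS : J \subset S by apply/subsetP => a; rewrite inE => /andP[].
have rJ : {in J, forall a, trans_rank a = r}.
  by move=> a; rewrite inE => /andP[_ /eqP].
have [||||B [leB sBJ BP]] :=
  generators_of_J clS regS rectJ (N := stirling2 n r) (rho := rho).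
- by exists g; rewrite inE gS rA ?eqxx.
- exact: card_ker_set.
- by apply: leq_trans leN; rewrite leq_add2r card_im_set.
- by [].
exists B; split=> //; split=> // [|U clU sBU]; first exact: subset_trans JS.
(* All generators in [A] have rank [r], so they lie in [J], which [B] generates. *)
apply: minS => //; apply: subset_trans (BP _ clU sBU).
by apply/subsetP => a aA; rewrite inE rA // eqxx (subsetP sAS).
Qed.
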